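(* For every infinite cardinal $\kappa$ there is an equivalent norm $|||\cdot|||$ on $\ell_2(\kappa)$ such that $\gamma^*((\ell_2(\kappa),|||\cdot|||))=1$. In particular, there are (infinite-dimensional) separable super-reflexive Banach spaces $X$ with $\gamma^*(X)=1$.
   Context: Spaces are real; $\ell_2(\kappa)$ is the Hilbert space of square-summable functions on a set of cardinality $\kappa$. In a normed space $X$, a set $P\subseteq X$ is $r$-separated if $\|x-y\|\ge r$ for all distinct $x,y\in P$, and $r$-dense if for every $x\in X$ there is $p\in P$ with $\|x-p\|\le r$. $\gamma^*(X)=\inf\{r>0:\text{there exists an }r\text{-dense and }2\text{-separated additive subgroup }P\subseteq X\}$. *)

(* Defs.v *)
From HB Require Import structures.
From mathcomp Require Import all_boot all_order all_algebra.
From mathcomp Require Import all_classical all_reals all_analysis.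
From mathcomp Require Import ring lra.

Set Implicit Arguments.
Unset Strict Implicit.
Unset Printing Implicit Defensive.

Import Order.TTheory GRing.Theory Num.Theory.
Import numFieldNormedType.Exports.

Local Open Scope classical_set_scope.
Local Open Scope ring_scope.

Section SquareSummable.
Context (R : realType) (I : choiceType).
Implicit Types (f g : I -> R^o) (a : R).

Definition esqsum f : \bar R := \esum_(i in [set: I]) ((f i) ^+ 2)%:E.

Definition square_summable : {pred I -> R^o} :=
  [pred f | `[< summable [set: I] (fun i => ((f i) ^+ 2)%:E) >] ].

Lemma square_summableE f : (f \in square_summable) = (esqsum f < +oo)%E.
Proof.
rewrite inE asboolb /summable; congr (_ < _)%E; apply: eq_esum => i _.
by rewrite abse_EFin ger0_norm ?sqr_ge0.
Qed.

Lemma esqsum_ge0 f : (0 <= esqsum f)%E.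
Proof. by apply: esum_ge0 => i _; rewrite lee_fin sqr_ge0. Qed.

Lemma esqsum_ge f i : (((f i) ^+ 2)%:E <= esqsum f)%E.
Proof.
apply: esum_ge; exists [set i]; first by split; [exact: finite_set1|].
by rewrite fsbig_set1.
Qed.

Lemma esumZl_le a (u : I -> R) : 0 <= a -> (forall i, 0 <= u i) ->
  (\esum_(i in [set: I]) (a * u i)%:E <=
     a%:E * \esum_(i in [set: I]) (u i)%:E)%E.
Proof.
move=> a0 u0; apply: ge_ereal_sup => _ [A finA <-].
under eq_fsbigr do rewrite EFinM.
rewrite -ge0_mule_fsumr; last by move=> i; rewrite lee_fin.
rewrite lee_wpmul2l ?lee_fin//.
by apply: ereal_sup_ubound; exists A.
Qed.

Lemma esqsumZ_le a f : (esqsum (a *: f) <= (a ^+ 2)%:E * esqsum f)%E.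
Proof.
rewrite /esqsum (eq_esum (b := fun i => (a ^+ 2 * f i ^+ 2)%:E)).
  by apply: esumZl_le => [|i]; rewrite sqr_ge0.
by move=> i _; rewrite -exprMn.
Qed.

Lemma sqrD_weighted_le s t (u v : R) : 0 < s -> 0 < t ->
  (u + v) ^+ 2 <= (1 + t / s) * u ^+ 2 + (1 + s / t) * v ^+ 2.
Proof.
move=> s0 t0; rewrite -subr_ge0.
rewrite [leRHS](_ : _ = (t * u - s * v) ^+ 2 / (s * t)); last first.
  by field; rewrite !gt_eqF.
by rewrite divr_ge0 ?sqr_ge0 ?mulr_ge0// ltW.
Qed.

Lemma esqsumD_le s t f g : 0 < s -> 0 < t ->
  (esqsum (f + g)%R <= (1 + t / s)%:E * esqsum f + (1 + s / t)%:E * esqsum g)%E.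
Proof.
move=> s0 t0; have st0 : 0 < s / t by rewrite divr_gt0.
have ts0 : 0 < t / s by rewrite divr_gt0.
apply: le_trans (leeD (esumZl_le _ _) (esumZl_le _ _)); last first.
- by move=> i; exact: sqr_ge0.
- by lra.
- by move=> i; exact: sqr_ge0.
- by lra.
rewrite -esumD; first last.
- by move=> i _; rewrite lee_fin mulr_ge0 ?sqr_ge0//; lra.
- by move=> i _; rewrite lee_fin mulr_ge0 ?sqr_ge0//; lra.
apply: le_esum => i _; rewrite -EFinD lee_fin; exact: sqrD_weighted_le.
Qed.

Lemma square_summable_submod : submod_closed square_summable.
Proof.
split=> [|a f g].
  by rewrite square_summableE /esqsum esum1// => i _; rewrite expr0n.
rewrite !square_summableE => ff gf.
apply: le_lt_trans (@esqsumD_le 1 1 _ _ ltr01 ltr01) _.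
have c0 : (0 <= (1 + 1 / 1 : R)%:E)%E by rewrite lee_fin divr1.
apply: lte_add_pinfty; apply: lte_mul_pinfty => //.
apply: le_lt_trans (esqsumZ_le a f) _.
by apply: lte_mul_pinfty => //; rewrite lee_fin sqr_ge0.
Qed.

HB.instance Definition _ := GRing.isSubmodClosed.Build R (I -> R^o)
  square_summable square_summable_submod.

Record ell2 := Ell2 {
  ell2_fun :> I -> R^o;
  ell2_funP : ell2_fun \in square_summable }.

HB.instance Definition _ := [isSub for ell2_fun].
HB.instance Definition _ := [Choice of ell2 by <:].
HB.instance Definition _ := [SubChoice_isSubLmodule of ell2 by <:].

Implicit Types (x y : ell2).

Definition ell2_norm (x : ell2) : R := Num.sqrt (fine (esqsum x)).

Lemma ell2_norm_ge0 x : 0 <= ell2_norm x.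
Proof. exact: sqrtr_ge0. Qed.

Lemma ell2_normE x : esqsum x = (ell2_norm x ^+ 2)%:E.
Proof.
rewrite sqr_sqrtr ?fine_ge0 ?esqsum_ge0// fineK// ge0_fin_numE ?esqsum_ge0//.
by rewrite -square_summableE ell2_funP.
Qed.

Lemma ell2_norm0_eq0 x : ell2_norm x = 0 -> x = 0.
Proof.
move=> x0; apply/val_inj/funext => i.
have := esqsum_ge x i; rewrite ell2_normE x0 expr0n/= lee_fin => xi0.
by apply/eqP; rewrite -sqrf_eq0 eq_le xi0 sqr_ge0.
Qed.

Lemma ell2_normZ_le a x : ell2_norm (a *: x) <= `|a| * ell2_norm x.
Proof.
have : (esqsum (a *: x)%R <= (a ^+ 2)%:E * esqsum x)%E by exact: esqsumZ_le.
rewrite !ell2_normE -EFinM lee_fin.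
rewrite -(real_normK (num_real a)) -exprMn.
by rewrite ler_sqr ?nnegrE ?mulr_ge0 ?ell2_norm_ge0.
Qed.

Lemma ell2_normZ a x : ell2_norm (a *: x) = `|a| * ell2_norm x.
Proof.
apply/eqP; rewrite eq_le ell2_normZ_le/=.
have [->|a0] := eqVneq a 0; first by rewrite normr0 mul0r ell2_norm_ge0.
have := ell2_normZ_le a^-1 (a *: x).
by rewrite scalerA mulVf// scale1r normfV ler_pdivlMl ?normr_gt0.
Qed.

Lemma ell2_normD x y : ell2_norm (x + y) <= ell2_norm x + ell2_norm y.
Proof.
have [/eqP/ell2_norm0_eq0->|x0] := boolP (ell2_norm x == 0).
  by rewrite add0r lerDr ell2_norm_ge0.
have [/eqP/ell2_norm0_eq0->|y0] := boolP (ell2_norm y == 0).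
  by rewrite addr0 lerDl ell2_norm_ge0.
have sx : 0 < ell2_norm x by rewrite lt0r x0 ell2_norm_ge0.
have sy : 0 < ell2_norm y by rewrite lt0r y0 ell2_norm_ge0.
have : (esqsum (x + y)%R <= (1 + ell2_norm y / ell2_norm x)%:E * esqsum x +
    (1 + ell2_norm x / ell2_norm y)%:E * esqsum y)%E by exact: esqsumD_le.
rewrite !ell2_normE -!EFinM -EFinD lee_fin.
rewrite [X in _ <= X -> _](_ : _ = (ell2_norm x + ell2_norm y) ^+ 2); last first.
  by field; rewrite x0 y0.
by rewrite ler_sqr// nnegrE ?addr_ge0 ?ell2_norm_ge0.
Qed.

HB.instance Definition _ := Lmodule_isNormed.Build R ell2
  ell2_normD ell2_normZ ell2_norm0_eq0.

End SquareSummable.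

Section Norms.
Context (R : realType) (V : lmodType R).

Definition is_norm (N : V -> R) : Prop :=
  [/\ forall x y, N (x + y) <= N x + N y,
      forall (a : R) x, N (a *: x) = `|a| * N x
    & forall x, N x = 0 -> x = 0].

Definition equivalent_norms (N1 N2 : V -> R) : Prop :=
  exists c C : R, [/\ 0 < c, 0 < C &
    forall x, c * N1 x <= N2 x /\ N2 x <= C * N1 x].

Definition separated (N : V -> R) (r : R) (P : set V) : Prop :=
  forall x y, P x -> P y -> x != y -> r <= N (x - y).

Definition r_dense (N : V -> R) (r : R) (P : set V) : Prop :=
  forall x, exists2 p, P p & N (x - p) <= r.

(* The infimum is taken in the extended reals: it is +oo for the empty set. *)
Definition gamma_star (N : V -> R) : \bar R :=
  ereal_inf [set r%:E | r in [set r : R | 0 < r /\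
    exists P : set V, [/\ zmod_closed (mem P), r_dense N r P & separated N 2 P]]].

Definition lin_span (n : nat) (v : 'I_n -> V) : set V :=
  [set x | exists c : 'I_n -> R, x = \sum_(i < n) c i *: v i].

Definition infinite_dimensional : Prop :=
  forall (n : nat) (v : 'I_n -> V), lin_span v != setT.

End Norms.

Definition separable (T : topologicalType) : Prop :=
  exists2 D : set T, countable D & dense D.

Section Dual.
Context (R : realType) (X : normedModType R).
Implicit Types (f : X -> R^o).

Definition continuous_linear : {pred X -> R^o} :=
  [pred f | `[< linear f /\ continuous f >] ].

Lemma continuous_linear_submod : submod_closed continuous_linear.
Proof.
split=> [|a f g].
  apply/asboolP; split=> [b x y|x]; last exact: cst_continuous.
  by rewrite [RHS]addr0 scaler0.
move=> /asboolP[lf cf] /asboolP[lg cg]; apply/asboolP; split=> [b x y|x].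
  rewrite ![(a *: f + g) _]/(a *: f _ + g _) lf lg !scalerDr !scalerA.
  by rewrite [b * a]mulrC addrACA.
apply: (@continuousD _ _ _ (a *: f) g); last exact: cg.
by apply: continuousZr; exact: cf.
Qed.

HB.instance Definition _ := GRing.isSubmodClosed.Build R (X -> R^o)
  continuous_linear continuous_linear_submod.

Record dual := Dual {
  dual_fun :> X -> R^o;
  dual_funP : dual_fun \in continuous_linear }.

HB.instance Definition _ := [isSub for dual_fun].
HB.instance Definition _ := [Choice of dual by <:].
HB.instance Definition _ := [SubChoice_isSubLmodule of dual by <:].

Definition dual_norm (f : dual) : R := sup [set `|f x| | x in [set x | `|x| <= 1]].

Lemma dual_linear (f : dual) : linear f.
Proof. by have /asboolP[] := dual_funP f. Qed.

Lemma dual0 (f : dual) : f 0 = 0.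
Proof.
by have := dual_linear f (-1) 0 0; rewrite scaler0 addr0 scaleN1r addNr.
Qed.

Lemma dualZ (f : dual) a x : f (a *: x) = a * f x.
Proof. by have := dual_linear f a x 0; rewrite dual0 !addr0. Qed.

Lemma dual_has_sup (f : dual) : has_sup [set `|f x| | x in [set x | `|x| <= 1]].
Proof.
have /asboolP[lf cf] := dual_funP f; split.
  by exists `|f 0|, 0 => //=; rewrite normr0.
pose L := GRing.isLinear.Build R X R^o *:%R f lf.
pose F : {linear X -> R^o} := HB.pack (dual_fun f) L.
have /linear_bounded_continuous/bounded_funP /(_ 1)[M fM] : continuous F by [].
by exists M => _ [x /= x1 <-]; exact: fM.
Qed.

Lemma dual_norm_ge0 (f : dual) : 0 <= dual_norm f.
Proof.
apply: le_trans (ub_le_sup (proj2 (dual_has_sup f)) _); last first.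
  by exists 0 => //=; rewrite normr0.
exact: normr_ge0.
Qed.

Lemma dual_norm_ge (f : dual) x : `|f x| <= dual_norm f * `|x|.
Proof.
have [->|x0] := eqVneq x 0; first by rewrite dual0 !normr0 mulr0.
have nx : 0 < `|x| by rewrite normr_gt0.
rewrite -ler_pdivrMr// mulrC; apply: ub_le_sup; first exact: (dual_has_sup f).2.
exists (`|x|^-1 *: x) => /=.
  by rewrite normrZ normfV normr_id mulVf// gt_eqF.
by rewrite dualZ normrM normfV normr_id.
Qed.

Lemma dual_norm_le (f : dual) (M : R) :
  (forall x, `|x| <= 1 -> `|f x| <= M) -> dual_norm f <= M.
Proof.
move=> fM; apply: ge_sup; last by move=> _ [x /= x1 <-]; exact: fM.
by case: (dual_has_sup f).
Qed.

Lemma dual_norm_le1 (f : dual) x : `|x| <= 1 -> `|f x| <= dual_norm f.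
Proof.
move=> x1; apply: le_trans (dual_norm_ge f x) _.
by rewrite -[leRHS]mulr1 ler_wpM2l ?dual_norm_ge0.
Qed.

Lemma dual_normD (f g : dual) : dual_norm (f + g) <= dual_norm f + dual_norm g.
Proof.
apply: dual_norm_le => x x1; apply: le_trans (ler_normD (f x) (g x)) _.
by rewrite lerD ?dual_norm_le1.
Qed.

Lemma dual_normZ_le a (f : dual) : dual_norm (a *: f) <= `|a| * dual_norm f.
Proof.
apply: dual_norm_le => x x1; rewrite [(a *: f) x]/(a * f x) normrM.
by rewrite ler_wpM2l ?dual_norm_le1.
Qed.

Lemma dual_normZ a (f : dual) : dual_norm (a *: f) = `|a| * dual_norm f.
Proof.
apply/eqP; rewrite eq_le dual_normZ_le/=.
have [->|a0] := eqVneq a 0; first by rewrite normr0 mul0r dual_norm_ge0.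
have := dual_normZ_le a^-1 (a *: f).
by rewrite scalerA mulVf// scale1r normfV ler_pdivlMl ?normr_gt0.
Qed.

Lemma dual_norm0_eq0 (f : dual) : dual_norm f = 0 -> f = 0.
Proof.
move=> f0; apply/val_inj/funext => x.
by have := dual_norm_ge f x; rewrite f0 mul0r normr_le0 => /eqP.
Qed.

HB.instance Definition _ := Lmodule_isNormed.Build R dual
  dual_normD dual_normZ dual_norm0_eq0.

End Dual.

(* Surjectivity of the canonical embedding of X into its bidual. *)
Definition reflexive_space (R : realType) (X : normedModType R) : Prop :=
  forall Phi : dual (dual X), exists x : X, forall f : dual X, Phi f = f x.

(* T is only required to be linear on the finite-dimensional subspace
   spanned by v; its values elsewhere are irrelevant. *)
Definition finitely_representable (R : realType) (Y X : normedModType R) : Prop :=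
  forall (e : R) (n : nat) (v : 'I_n -> Y), 0 < e ->
  exists T : Y -> X,
    (forall (a : R) y z, lin_span v y -> lin_span v z ->
       T (a *: y + z) = a *: T y + T z) /\
    (forall y, lin_span v y ->
       (1 - e) * `|y| <= `|T y| /\ `|T y| <= (1 + e) * `|y|).

(* James' definition: every Banach space that is finitely representable in X
   is reflexive. *)
Definition super_reflexive (R : realType) (X : normedModType R) : Prop :=
  forall Y : completeNormedModType R,
    finitely_representable Y X -> reflexive_space Y.

(* Main.v *)
Require Import Defs.
From HB Require Import structures.
From mathcomp Require Import all_boot all_order all_algebra.
From mathcomp Require Import all_classical all_reals all_analysis.
From mathcomp Require Import ring lra.

Set Implicit Arguments.
Unset Strict Implicit.
Unset Printing Implicit Defensive.

Import Order.TTheory GRing.Theory Num.Theory.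
Import numFieldNormedType.Exports.

Local Open Scope classical_set_scope.
Local Open Scope ring_scope.

(** The norm is the gauge of a Voronoi cell.  Let D be a subgroup of a Hilbert
    space H whose nonzero elements have length at least 1 and such that every
    point of H lies within distance r of D, and put
      N(x) = sup over nonzero d in D of 2 |<x,d>| / |d|^2,
    so that the unit ball of N is the set of the points that are at least as
    close to 0 as to any other point of D.  By Cauchy-Schwarz N <= 2 |.|, and a
    point of the cell is within r of 0 because 0 is the point of D nearest to
    it, so |.| <= r N: the norms are equivalent.  Taking the slope of d against
    itself gives N(d) >= 2 for nonzero d in D, so D is 2-separated for N.
    Nearest points in D need not exist in infinite dimension, but a point d with
    |x-d|^2 <= dist(x,D)^2 + e satisfies 2 <x-d,d'> <= |d'|^2 + e for all d' in
    D, hence N(x-d) <= 1 + e, and gamma* <= 1.  Conversely gamma* >= 1 in every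
    nonzero normed space: if r < 1, a vector of norm 1 is within r of an element
    p of the subgroup, p is not 0 and has norm at most 1 + r < 2.

    It remains to find D in ell2(I), for I infinite (lattice_separated,
    lattice_dense).  List the finitely supported rational vectors v, and let D
    be generated by the vectors v + e_i(v), where i(v) is a coordinate outside
    the supports of v and of the vectors listed before v, chosen injectively.
    Every v is within 1 of D; and in a nonzero integer combination of the
    generators, the last v that occurs gives the coordinate i(v) a nonzero
    integer value, so that the norm is at least 1.  No transfinite list is
    necessary: the coordinates are graded by natural numbers so that each v can
    pick its own coordinate in the grade just above its support.  This asks for
    as many indices as finite lists of indices, which is Hessenberg's theorem
    that I x I injects into I (infinite_pairing).

    For the second part, ell2(nat) is renormed in this way.  If Y is finitely
    representable in a space whose norm is equivalent to a Hilbertian one, the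
    inner products pulled back from the almost isometric copies of the finite
    dimensional subspaces of Y converge along an ultrafilter to an inner product
    on Y that defines an equivalent norm (inner_super_reflexive).  Since Y is
    complete, the Riesz representation theorem holds for this inner product, and
    applying it once to a functional on the dual and once to a functional on Y
    gives reflexivity (inner_reflexive). *)

(** * Finite lists over an infinite set inject into the set *)

Section Cardinals.
Variable I : choiceType.
Implicit Types (A B J : set I) (f : I -> I -> I).

(** Comparability of cardinals: a maximal partial injection between A and B,
    seen as a graph, exhausts A or B. *)
Lemma set_inj_total A B :
  (exists2 f, set_fun A B f & set_inj A f) \/
  (exists2 f, set_fun B A f & set_inj B f).
Proof.
pose P : set (set (I * I)) := [set G | G `<=` A `*` B /\
  forall p q, G p -> G q -> p.1 = q.1 <-> p.2 = q.2].
have [F FP totF|G [[GAB Ginj] Gmax]] := @Zorn_bigcup _ P.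
  split=> [p [G /FP[GAB _] /GAB]//|p q [G FG Gp] [H FH Hq]].
  have [GH|HG] := totF _ _ FG FH.
    by have [_] := FP _ FH; apply => //; exact: GH.
  by have [_] := FP _ FG; apply => //; exact: HG.
have [Atot|/existsNP[a /not_implyP[Aa Ga]]] :=
    pselect (forall a, A a -> exists b, G (a, b)).
  left; pose f a := xget a [set b | G (a, b)].
  have Gf a : A a -> G (a, f a).
    by move=> /Atot[b Gab]; rewrite /f; case: xgetP => [_ ->|/(_ b)].
  exists f => [a /Gf/GAB[]//|a a' /[!inE] /Gf Ga /Gf Ga' ff].
  by have [_ /(_ ff)] := Ginj _ _ Ga Ga'.
right.
have Btot b : B b -> exists a, G (a, b).
  move=> Bb; apply/not_existsP => Gb.
  apply: (Gmax (G `|` [set (a, b)])).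
    split; first by apply/subsetUl.
    by move=> /(_ (a, b)) Gab; apply: (Gb a); apply: Gab; right.
  split=> [p [/GAB//|->//]|p q].
  move=> [Gp|->] [Gq|->] //=.
  - exact: Ginj.
  - split=> pE.
      by case: Ga; exists p.2; rewrite -pE -surjective_pairing.
    by case: (Gb p.1); rewrite -pE -surjective_pairing.
  - split=> qE.
      by case: Ga; exists q.2; rewrite qE -surjective_pairing.
    by case: (Gb q.1); rewrite qE -surjective_pairing.
pose f b := xget b [set a | G (a, b)].
have Gf b : B b -> G (f b, b).
  by move=> /Btot[a' Gab]; rewrite /f; case: xgetP => [_ ->|/(_ a')].
exists f => [b /Gf/GAB[]//|b b' /[!inE] /Gf Gb /Gf Gb' ff].
by have [/(_ ff)] := Ginj _ _ Gb Gb'.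
Qed.

Definition pairing_on J f :=
  (forall x y, J x -> J y -> J (f x y)) /\
  (forall x y x' y', J x -> J y -> J x' -> J y' ->
     f x y = f x' y' -> x = x' /\ y = y').

(** The starting point of the maximality argument: it keeps J infinite, hence
    with two distinct elements to use as tags. *)
Lemma pairing_range (e : nat -> I) : injective e ->
  exists f, pairing_on (range e) f.
Proof.
move=> einj; pose n x := xget 0%N [set k | e k = x].
have nE k : n (e k) = k.
  by rewrite /n; case: xgetP => [m _ /einj//|/(_ k)/(_ erefl)].
exists (fun x y => e (pickle (n x, n y))); split=> [x y _ _|].
  by apply: imageP.
move=> _ _ _ _ [x _ <-] [y _ <-] [x' _ <-] [y' _ <-] /einj.
by rewrite !nE => /(pcan_inj pickleK)[-> ->].
Qed.

(** Tagging with two distinct elements a and b embeds the disjoint sum of J with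
    itself into J, so a set no larger than J can be absorbed. *)
Lemma pairing_absorb J f a b A (g : I -> I) : pairing_on J f ->
  J a -> J b -> a <> b -> set_fun A J g -> set_inj A g ->
  exists2 c, set_fun (J `|` A) J c & set_inj (J `|` A) c.
Proof.
move=> [fJ finj] Ja Jb ab gA ginj.
exists (fun x => if pselect (J x) then f a x else f b (g x)).
  move=> x JAx /=; case: pselect => [Jx|nJx]; first exact: fJ.
  by case: JAx => // Ax; apply: fJ => //; exact: gA.
move=> x y /set_mem JAx /set_mem JAy.
case: pselect => [Jx|nJx]; case: pselect => [Jy|nJy].
- by move=> /finj[].
- by case: JAy => // Ay /finj[]//; exact: gA.
- by case: JAx => // Ax /finj[]//; [exact: gA|move/esym].
case: JAx JAy => // Ax [//|Ay] /finj[]//; try exact: gA.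
by move=> _; apply: ginj; rewrite inE.
Qed.

Lemma infinite_nat_inj : infinite_set [set: I] ->
  exists e : nat -> I, injective e.
Proof.
move=> /infiniteP/card_leP[e].
exists (fun n => val (e (SigSub (mem_set (Logic.I : [set: nat] n))))).
move=> m n /val_inj ee.
by have [] := @inj _ _ _ e _ _ (mem_set Logic.I) (mem_set Logic.I) ee.
Qed.

(** Hessenberg's theorem.  Take J maximal among the sets that contain a fixed
    countable set and carry a pairing.  If the complement of J injects into J,
    the whole type does, and the pairing is pulled back.  Otherwise J has a
    disjoint copy A in its complement; J together with A still injects into J, so
    the pairs not in J x J can be sent injectively into A, and the pairing
    extends, against maximality. *)
Lemma infinite_pairing : infinite_set [set: I] ->
  exists f : I -> I -> I, forall x y x' y', f x y = f x' y' -> x = x' /\ y = y'.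
Proof.
move=> /infinite_nat_inj[e einj].
have [f0 f0P] := pairing_range einj.
pose T := {p : set I * (I -> I -> I) | range e `<=` p.1 /\ pairing_on p.1 p.2}.
pose R (s t : T) := `[< (sval s).1 `<=` (sval t).1 /\
  forall x y, (sval s).1 x -> (sval s).1 y -> (sval t).2 x y = (sval s).2 x y >].
pose t0 : T := exist _ (range e, f0) (conj (@subset_refl _ _) f0P).
have Rtrans r s t : R r s -> R s t -> R r t.
  move=> /asboolP[rs rsE] /asboolP[st stE]; apply/asboolP; split.
    exact: subset_trans st.
  by move=> x y rx ry; rewrite stE ?rsE//; exact: rs.
have [t|F totF|[[J f] [/= eJ fP]] tmax] := @ZL_preorder T t0 R _ Rtrans _.
- by apply/asboolP; split.
- have [->|/set0P[s Fs]] := eqVneq F set0; first by exists t0.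
  pose J := \bigcup_(t in F) (sval t).1.
  pose good x y : set T := [set t | F t /\ (sval t).1 x /\ (sval t).1 y].
  pose f x y :=
    if pselect (exists t, good x y t) is left ex then (sval (sval (cid ex))).2 x y
    else x.
  have fE t x y : F t -> (sval t).1 x -> (sval t).1 y -> f x y = (sval t).2 x y.
    move=> Ft tx ty; rewrite /f; case: pselect => [ex|]; last by case; exists t.
    have [Fu [ux uy]] := svalP (cid ex); move: (sval (cid ex)) Fu ux uy => u Fu ux uy.
    by have [/asboolP[_ uE]|/asboolP[_ uE]] := totF _ _ Ft Fu; rewrite uE.
  have good2 x y : J x -> J y -> exists t, good x y t.
    move=> [t Ft tx] [u Fu uy].
    by have [/asboolP[tu _]|/asboolP[ut _]] := totF _ _ Ft Fu;
      [exists u|exists t]; split=> //; split=> //; [exact: tu|exact: ut].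
  have fP : pairing_on J f.
    split=> [x y Jx Jy|x y x' y' Jx Jy Jx' Jy'].
      have [t [Ft [tx ty]]] := good2 _ _ Jx Jy.
      exists t => //; rewrite (fE t)//.
      by have [_ []] := svalP t => tJ _; exact: tJ.
    have [t [Ft [tx ty]]] := good2 _ _ Jx Jy.
    have [u [Fu [ux uy]]] := good2 _ _ Jx' Jy'.
    have [/asboolP[tu _]|/asboolP[ut _]] := totF _ _ Ft Fu.
      rewrite !(fE u)//; try exact: tu.
      by have [_ [_ uinj]] := svalP u; apply: uinj => //; exact: tu.
    rewrite !(fE t)//; try exact: ut.
    by have [_ [_ tinj]] := svalP t; apply: tinj => //; exact: ut.
  have eJ : range e `<=` J.
    by apply: (subset_trans (svalP s).1) => x sx; exists s.
  exists (exist _ (J, f) (conj eJ fP)) => t Ft; apply/asboolP; split=> /=.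
    by move=> x tx; exists t.
  by move=> x y tx ty; rewrite (fE t).
have [a [b [Ja Jb ab]]] : exists a b, [/\ J a, J b & a <> b].
  exists (e 0%N), (e 1%N); split; try by apply: (eJ); apply: imageP.
  by move=> /einj.
have [fJ finj] := fP.
have [[g gJ ginj]|[h hJ hinj]] := set_inj_total (~` J) J.
  have [c cJ cinj] := pairing_absorb fP Ja Jb ab gJ ginj.
  have cJ' x : J (c x) by apply: cJ; rewrite setUv.
  exists (fun x y => f (c x) (c y)) => x y x' y' /finj[]// cx cy.
  by split; apply: cinj => //; rewrite setUv inE.
pose A := h @` J; pose g y := xget y [set x | J x /\ h x = y].
have gP y : A y -> J (g y) /\ h (g y) = y.
  by move=> [x Jx hx]; rewrite /g; case: xgetP => [_ -> []//|/(_ x)[]].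
have AJ y : A y -> ~ J y by move=> [x Jx <-]; exact: hJ.
have [y /gP[]//|y y' /[!inE] /gP[_ yE] /gP[_ yE'] gg|c cJ cinj] :=
  @pairing_absorb J f a b A g fP Ja Jb ab.
  by rewrite -yE -yE' gg.
pose F x y := if pselect (J x /\ J y) then f x y else h (f (c x) (c y)).
pose J' := J `|` A.
have FP : pairing_on J' F.
  have FA x y : J' x -> J' y -> A (h (f (c x) (c y))).
    by move=> J'x J'y; apply: imageP; apply: (fJ); exact: cJ.
  split=> [x y J'x J'y|x y x' y' J'x J'y J'x' J'y'].
    rewrite /F; case: pselect => [[Jx Jy]|nJ] /=; first by left; exact: fJ.
    by right; exact: FA.
  rewrite /F; case: pselect => [[Jx Jy]|nJ] /=; case: pselect => [[Jx' Jy']|nJ'] /=.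
  - exact: finj.
  - by move=> ff; have /AJ[] := FA _ _ J'x' J'y'; rewrite -ff; exact: fJ.
  - by move=> ff; have /AJ[] := FA _ _ J'x J'y; rewrite ff; exact: fJ.
  move=> /hinj; rewrite !inE => /(_ (fJ _ _ (cJ _ J'x) (cJ _ J'y))).
  move=> /(_ (fJ _ _ (cJ _ J'x') (cJ _ J'y')))/finj.
  by case=> [||||/cinj + /cinj]; try exact: cJ; rewrite !inE => -> // ->.
have eJ' : range e `<=` J' by apply: (subset_trans eJ); exact: subsetUl.
have /asboolP[/= J'J _] :
    R (exist _ (J', F) (conj eJ' FP)) (exist _ (J, f) (conj eJ fP)).
  apply: tmax; apply/asboolP; split=> /=; first exact: subsetUl.
  by move=> x y Jx Jy; rewrite /F; case: pselect => // -[].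
have Aha : A (h a) by exists a.
by case: (AJ _ Aha); apply: J'J; right.
Qed.

End Cardinals.

(** A list is coded by its length together with iterated pairing: the iterated
    pairing alone is only injective among lists of the same length. *)
Lemma infinite_seq_code (I : choiceType) (C : countType) :
  infinite_set [set: I] ->
  exists e : seq (I * C) -> nat -> I,
    forall s m t n, e s m = e t n -> s = t /\ m = n.
Proof.
move=> infI; have [f finj] := infinite_pairing infI.
have [e einj] := infinite_nat_inj infI.
pose g (p : I * C) := f p.1 (e (pickle p.2)).
have ginj : injective g.
  by move=> [x c] [y d] /finj[/= -> /einj/(pcan_inj pickleK)->].
pose h := foldr f (e 0%N).
have hinj s t : size s = size t -> h s = h t -> s = t.
  elim: s t => [|x s IHs] [|y t]//= [st] /finj[-> /IHs ->//].
exists (fun s m => f (f (e (size s)) (h (map g s))) (e m)) => s m t n.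
move=> /finj[/finj[/einj st /hinj] + /einj mn].
by rewrite !size_map => /(_ st)/(inj_map ginj).
Qed.

(** * Square-summable families: inner product and dense rational vectors *)

(* Simplification would turn a coordinate of a sum of vectors into the value of a
   sum of functions. *)
#[local] Arguments ell2_fun : simpl never.

Section Ell2.
Context (R : realType) (I : choiceType).
Implicit Types (x y z : ell2 R I) (i : I).

Lemma ell2E x : esqsum x = (`|x| ^+ 2)%:E. Proof. exact: ell2_normE. Qed.

Lemma ell2D x y i : (x + y) i = x i + y i. Proof. by []. Qed.
Lemma ell2N x i : (- x) i = - x i. Proof. by []. Qed.
Lemma ell2Z a x i : (a *: x) i = a * x i. Proof. by []. Qed.

Lemma ell2_sumE (T : Type) (s : seq T) (F : T -> ell2 R I) i :
  (\sum_(p <- s) F p) i = \sum_(p <- s) F p i.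
Proof.
elim: s => [|p s IHs]; first by rewrite !big_nil.
by rewrite !big_cons -IHs.
Qed.

Lemma coord_le x i : `|x i| <= `|x|.
Proof.
have := esqsum_ge x i; rewrite ell2E lee_fin -[x i ^+ 2]real_normK ?num_real//.
by rewrite ler_sqr ?nnegrE.
Qed.

Lemma sumsq_le x (s : seq I) : uniq s ->
  \sum_(i <- s) x i ^+ 2 <= `|x| ^+ 2.
Proof.
move=> us; rewrite -lee_fin -ell2E; apply: esum_ge; exists [set` s].
  by split => //; exact: finite_seq.
by rewrite -fsbig_seq// sumEFin.
Qed.

(** The nonnegativity of the coefficients lets the unordered sum commute with
    the finite one: a nonnegative coefficient is a square, and is absorbed into
    the vector. *)
Lemma esqsum_comb (s : seq (R * ell2 R I)) : all (fun p => 0 <= p.1) s ->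
  (\esum_(i in [set: I]) (\sum_(p <- s) p.1 * p.2 i ^+ 2)%:E =
   (\sum_(p <- s) p.1 * `|p.2| ^+ 2)%:E)%E.
Proof.
elim: s => [|p s IHs] /=.
  by move=> _; rewrite big_nil esum1// => i _; rewrite big_nil.
move=> /andP[p0 s0]; rewrite big_cons EFinD -IHs//.
have -> : (p.1 * `|p.2| ^+ 2)%:E = esqsum (Num.sqrt p.1 *: p.2).
  by rewrite ell2E normrZ exprMn (ger0_norm (sqrtr_ge0 _)) (sqr_sqrtr p0).
rewrite -esumD; first last.
- move=> i _; rewrite lee_fin; elim: s s0 {IHs} => [|q s IHs] /=; rewrite ?big_nil//.
  by move=> /andP[q0 /IHs sge]; rewrite big_cons addr_ge0// mulr_ge0 ?sqr_ge0.
- by move=> i _; rewrite lee_fin sqr_ge0.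
apply: eq_esum => i _; rewrite big_cons EFinD; congr (_%:E + _)%E.
by rewrite exprMn sqr_sqrtr.
Qed.

(** Quadratic inequalities between the coordinates pass to the norms.  Terms are
    first separated according to the sign of their coefficients, so that only
    sums of nonnegative terms are ever compared. *)
Lemma sqnorm_comb_ge0 (s : seq (R * ell2 R I)) :
  (forall i, 0 <= \sum_(p <- s) p.1 * p.2 i ^+ 2) ->
  0 <= \sum_(p <- s) p.1 * `|p.2| ^+ 2.
Proof.
move=> s0.
pose pos := [seq (Num.max p.1 0, p.2) | p <- s].
pose neg := [seq (Num.max (- p.1) 0, p.2) | p <- s].
have split_pn (G : ell2 R I -> R) : \sum_(p <- s) p.1 * G p.2 =
    \sum_(p <- pos) p.1 * G p.2 - \sum_(p <- neg) p.1 * G p.2.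
  rewrite !big_map -sumrB; apply: eq_bigr => p _ /=; rewrite -mulrBl.
  by congr (_ * _); rewrite /Num.max; case: ltP => ?; case: ltP => ?; lra.
have pos0 : all (fun p => 0 <= p.1) pos.
  by apply/allP => _ /mapP[p _ ->] /=; rewrite le_max lexx orbT.
have neg0 : all (fun p => 0 <= p.1) neg.
  by apply/allP => _ /mapP[p _ ->] /=; rewrite le_max lexx orbT.
rewrite (split_pn (fun x => `|x| ^+ 2)) subr_ge0 -lee_fin.
rewrite -(esqsum_comb pos0) -(esqsum_comb neg0); apply: le_esum => i _.
by rewrite lee_fin -subr_ge0 -(split_pn (fun x => x i ^+ 2)).
Qed.

Lemma sqnorm_comb_eq0 (s : seq (R * ell2 R I)) :
  (forall i, \sum_(p <- s) p.1 * p.2 i ^+ 2 = 0) ->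
  \sum_(p <- s) p.1 * `|p.2| ^+ 2 = 0.
Proof.
move=> s0; apply/eqP; rewrite eq_le sqnorm_comb_ge0 ?andbT => [|i]; last by rewrite s0.
rewrite -oppr_ge0 -sumrN.
have := @sqnorm_comb_ge0 [seq (- p.1, p.2) | p <- s].
rewrite big_map => H; under eq_bigr do rewrite -mulNr; apply: H => i.
by rewrite big_map; under eq_bigr do rewrite mulNr; rewrite sumrN s0 oppr0.
Qed.

(** The polarization of the norm: the identities that make it bilinear are
    linear relations between squared norms, which sqnorm_comb_eq0 reduces to
    ring identities in one coordinate. *)
Definition dot x y : R := (`|x + y| ^+ 2 - `|x| ^+ 2 - `|y| ^+ 2) / 2.

Lemma dotC x y : dot x y = dot y x.
Proof. by rewrite /dot [y + x]addrC addrAC. Qed.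

Lemma dotDl x y z : dot (x + y) z = dot x z + dot y z.
Proof.
have := @sqnorm_comb_eq0 [:: (1, x + y + z); (-1, x + y); (-1, x + z); (1, x);
  (-1, y + z); (1, y); (1, z)].
rewrite !big_cons big_nil /dot /=.
move: (`|x + y + z|) (`|x + y|) (`|x + z|) (`|x|) (`|y + z|) (`|y|) (`|z|).
move=> nxyz nxy nxz nx nyz ny nz H.
suff H' : 1 * nxyz ^+ 2 + (-1 * nxy ^+ 2 + (-1 * nxz ^+ 2 + (1 * nx ^+ 2 +
   (-1 * nyz ^+ 2 + (1 * ny ^+ 2 + (1 * nz ^+ 2 + 0)))))) = 0 by lra.
apply: H => i; rewrite !big_cons big_nil /=.
rewrite !ell2D.
by move: (x i : R) (y i : R) (z i : R) => a b c; ring.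
Qed.

Lemma dotZl a x y : dot (a *: x) y = a * dot x y.
Proof.
have := @sqnorm_comb_eq0 [:: (1, a *: x + y); (-1, a *: x); (-1, y);
  (- a, x + y); (a, x); (a, y)].
rewrite !big_cons big_nil /dot /=.
move: (`|a *: x + y|) (`|a *: x|) (`|x + y|) (`|x|) (`|y|).
move=> naxy nax nxy nx ny H.
suff H' : 1 * naxy ^+ 2 + (-1 * nax ^+ 2 + (-1 * ny ^+ 2 + (- a * nxy ^+ 2 +
  (a * nx ^+ 2 + (a * ny ^+ 2 + 0))))) = 0 by lra.
apply: H => i; rewrite !big_cons big_nil /=.
rewrite !(ell2D, ell2Z).
by move: (x i : R) (y i : R) => b c; ring.
Qed.

Lemma dotxx x : dot x x = `|x| ^+ 2.
Proof.
rewrite /dot -mulr2n -scaler_nat normrZ normr_nat exprMn.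
by move: `|x| => n; field.
Qed.

Lemma delta_subproof i : (fun j => (j == i)%:R : R^o) \in @square_summable R I.
Proof.
rewrite square_summableE /esqsum.
rewrite (eq_esum (b := fun j => if j \in [set i] then 1%E else 0%E)) => [|j _].
  by rewrite -esum_mkcond esum_set1// ltry.
have -> : (j \in [set i]) = (j == i) by apply/idP/eqP; rewrite in_setE.
by case: eqP => _; rewrite ?expr1n// expr0n.
Qed.

Definition delta i : ell2 R I := Ell2 (delta_subproof i).

Lemma deltaE i j : delta i j = (j == i)%:R. Proof. by []. Qed.

Lemma norm_delta i : `|delta i| = 1.
Proof.
apply/eqP; rewrite -(@eqrXn2 _ 2)// expr1n -eqe -ell2E /esqsum.
rewrite (eq_esum (b := fun j => if j \in [set i] then 1%E else 0%E)) => [|j _].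
  by rewrite -esum_mkcond esum_set1.
have -> : (j \in [set i]) = (j == i) by apply/idP/eqP; rewrite in_setE.
by rewrite deltaE; case: eqP => _; rewrite ?expr1n// expr0n.
Qed.

Definition ratvec (s : seq (I * rat)) : ell2 R I :=
  \sum_(p <- s) ratr p.2 *: delta p.1.

Lemma ratvec_coord0 (s : seq (I * rat)) i :
  (forall p, p \in s -> p.1 != i) -> ratvec s i = 0.
Proof.
move=> si; rewrite ell2_sumE big_seq big1// => p /si pi.
by rewrite ell2Z deltaE eq_sym (negPf pi) mulr0.
Qed.

(** The unordered sum of the squares is a supremum of finite sums; by
    orthogonality the squared distance from x to its restriction to s is the
    difference between the total sum and the sum over s. *)
Lemma finite_part_dense x e : 0 < e -> exists2 s : seq I, uniq s &
  `|x - \sum_(i <- s) x i *: delta i| < e.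
Proof.
move=> e0; have e20 : 0 < e ^+ 2 by rewrite exprn_gt0.
have : esqsum x \is a fin_num by rewrite ell2E.
move=> /(ub_ereal_sup_adherent e20)[_ [A [finA _] <-]].
rewrite -/(esum _ _) -/(esqsum x) ell2E -EFinB.
have [s us sE] : exists2 s : seq I, uniq s & A = [set` s].
  by exists (finmap.enum_fset (fset_set A)); [exact: finmap.fset_uniq|rewrite fset_setK].
rewrite {A finA}sE -fsbig_seq// sumEFin lte_fin => sx.
exists s => //; set y := \sum_(i <- s) _.
have yE i : y i = if i \in s then x i else 0.
  rewrite ell2_sumE.
  under eq_bigr => j _ do rewrite ell2Z deltaE mulr_natr mulrb.
  case: ifPn => si.
    rewrite (bigD1_seq i)//= eqxx big1 ?addr0// => j /negPf ji.
    by rewrite eq_sym ji.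
  by rewrite big_seq big1// => j sj; case: eqP => // ij; rewrite ij sj in si.
have := @sqnorm_comb_eq0 [:: (1, x); (-1, y); (-1, x - y)].
rewrite !big_cons !big_nil /= !mul1r !mulN1r => H.
have {H} : `|x| ^+ 2 + (- `|y| ^+ 2 + (- `|x - y| ^+ 2 + 0)) = 0.
  apply: H => i; rewrite !big_cons big_nil /=.
  rewrite !(ell2D, ell2N).
  by rewrite yE; move: (x i : R) => c; case: ifP => _; ring.
have ys : \sum_(i <- s) x i ^+ 2 <= `|y| ^+ 2.
  apply: le_trans (sumsq_le y us); rewrite le_eqVlt; apply/orP; left; apply/eqP.
  by rewrite !big_seq; apply: eq_bigr => i si; rewrite yE si.
move=> xy; have : `|x - y| ^+ 2 < e ^+ 2 by lra.
by rewrite ltr_pXn2r// nnegrE// ltW.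
Qed.

Lemma ratvec_dense x e : 0 < e -> exists s, `|x - ratvec s| < e.
Proof.
move=> e0; have e20 : 0 < e / 2 by lra.
have [s us xs] := finite_part_dense x e20.
suff [t yt] : exists t, `|\sum_(i <- s) x i *: delta i - ratvec t| < e / 2.
  exists t; rewrite -(subrK (\sum_(i <- s) x i *: delta i) x) -addrA.
  by apply: le_lt_trans (ler_normD _ _) _; lra.
elim: s (e / 2) e20 {us xs} => [|i s IHs] d d0.
  by exists [::]; rewrite /ratvec !big_nil subr0 normr0.
have d20 : 0 < d / 2 by lra.
have [t st] := IHs _ d20.
have [q] : exists q, ratr q \in `](x i - d / 2), (x i + d / 2)[.
  by apply: rat_in_itvoo; lra.
rewrite in_itv /= => /andP[q1 q2].
exists ((i, q) :: t); rewrite /ratvec !big_cons /= opprD addrACA -scalerBl.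
apply: le_lt_trans (ler_normD _ _) _; rewrite normrZ norm_delta mulr1.
have : `|x i - ratr q| < d / 2 by rewrite ltr_norml; apply/andP; split; lra.
by move: st; rewrite /ratvec; lra.
Qed.

End Ell2.

(** * The Voronoi norm of a separated, relatively dense subgroup *)

Section GammaStar.
Context (R : realType) (V : lmodType R) (N : V -> R).

(** For r < 1, an element of the subgroup within r of a unit vector is nonzero,
    and shorter than 2. *)
Lemma gamma_star_ge1 : is_norm N -> (exists x : V, x != 0) ->
  (1%:E <= gamma_star N)%E.
Proof.
move=> [ND NZ N0] [x x0]; apply: le_ereal_inf_tmp => _ [r [r0 [P [zP dP sP]]] <-].
rewrite lee_fin leNgt; apply/negP => r1.
have Nx0 : N x != 0 by apply: contraNneq x0 => /N0 ->.
have Nge0 y : 0 <= N y.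
  have := ND y (- y); rewrite subrr -scaleN1r NZ normrN1 mul1r.
  by rewrite -(scale0r y) NZ normr0 mul0r; lra.
have Nu : N ((N x)^-1 *: x) = 1 by rewrite NZ ger0_norm ?invr_ge0// mulVf.
move: (_ *: x) Nu => u Nu.
have [p Pp Np] := dP u.
have P0 : P 0 by apply/set_mem; exact: zP.1.
have NB y z : N (y - z) = N (z - y).
  by rewrite -opprB -[- (z - y)]scaleN1r NZ normrN1 mul1r.
have [p0|p0] := eqVneq p 0; first by move: Np; rewrite p0 subr0 Nu; lra.
have := sP _ _ Pp P0 p0; have := ND (p - u) (u - 0).
by rewrite addrA subrK !subr0 Nu NB; lra.
Qed.

End GammaStar.

Section Inner.
Context (R : realType) (V : lmodType R) (B : V -> V -> R).

Definition inner_product := [/\ forall x y, B x y = B y x,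
  forall x y z, B (x + y) z = B x z + B y z,
  forall a x y, B (a *: x) y = a * B x y & forall x, 0 <= B x x].

Hypothesis BP : inner_product.

Lemma innerC x y : B x y = B y x. Proof. by case: BP. Qed.
Lemma innerDl x y z : B (x + y) z = B x z + B y z. Proof. by case: BP. Qed.
Lemma innerZl a x y : B (a *: x) y = a * B x y. Proof. by case: BP. Qed.
Lemma innerxx_ge0 x : 0 <= B x x. Proof. by case: BP. Qed.
Lemma innerDr x y z : B x (y + z) = B x y + B x z.
Proof. by rewrite !(innerC x) innerDl. Qed.
Lemma innerZr a x y : B x (a *: y) = a * B x y.
Proof. by rewrite !(innerC x) innerZl. Qed.
Lemma innerNl x y : B (- x) y = - B x y.
Proof. by rewrite -scaleN1r innerZl mulN1r. Qed.
Lemma innerNr x y : B x (- y) = - B x y.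
Proof. by rewrite !(innerC x) innerNl. Qed.

Lemma inner_sqD x y : B (x + y) (x + y) = B x x + 2 * B x y + B y y.
Proof. by rewrite !(innerDl, innerDr) (innerC y x); ring. Qed.
Lemma inner_sqB x y : B (x - y) (x - y) = B x x - 2 * B x y + B y y.
Proof. by rewrite inner_sqD !(innerNl, innerNr); ring. Qed.

(** Positivity of the quadratic polynomial t |-> B(x - ty, x - ty); the form
    may be degenerate, so the case B y y = 0 needs a large value of t. *)
Lemma cauchy_schwarz x y : B x y ^+ 2 <= B x x * B y y.
Proof.
have key t : 0 <= B x x - 2 * t * B x y + t ^+ 2 * B y y.
  have := innerxx_ge0 (x - t *: y); rewrite inner_sqB !(innerZr, innerZl).
  by rewrite expr2; lra.
move: (B x x) (B y y) (B x y) (innerxx_ge0 y) key => a b c b0 key.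
have [b00|bn0] := eqVneq b 0.
  have [->|c0] := eqVneq c 0; first by rewrite b00 expr0n mulr0.
  have := key ((a + 1) / (2 * c)); rewrite b00 mulr0 addr0.
  have -> : 2 * ((a + 1) / (2 * c)) * c = a + 1 by field.
  by lra.
have bp : 0 < b by rewrite lt0r bn0.
have := key (c / b).
have -> : a - 2 * (c / b) * c + (c / b) ^+ 2 * b = (a * b - c ^+ 2) / b by field.
by rewrite pmulr_lge0 ?invr_gt0// subr_ge0.
Qed.

End Inner.

Section Voronoi.
Context (R : realType) (V : lmodType R) (B : V -> V -> R).
Hypotheses (BP : inner_product B) (Bdef : forall x, B x x = 0 -> x = 0).
Context (D : set V) (r : R).
Hypotheses (Dgroup : zmod_closed (mem D))
  (Dsep : forall d, D d -> d != 0 -> 1 <= B d d)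
  (Ddense : forall x, exists2 d, D d & B (x - d) (x - d) <= r ^+ 2)
  (r0 : 0 < r) (Vn0 : exists x : V, x != 0).

Let D0 : D 0. Proof. by apply/set_mem; exact: Dgroup.1. Qed.

Let DB x y : D x -> D y -> D (x - y).
Proof. by move=> /mem_set Dx /mem_set Dy; apply/set_mem; exact: Dgroup.2. Qed.

Let DN x : D x -> D (- x).
Proof. by move=> Dx; rewrite -sub0r; exact: DB. Qed.

(** The slope along d is at most 1 exactly between the bisectors of 0 with d and
    of 0 with -d, so the unit ball of voronoi_norm is the Voronoi cell of 0. *)
Definition slopes x : set R :=
  [set 2 * `|B x d| / B d d | d in [set d | D d /\ d != 0]].

Definition voronoi_norm x : R := sup (slopes x).

Local Notation N := voronoi_norm.

Lemma lattice_neq0 : exists d, D d /\ d != 0.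
Proof.
have [x x0] := Vn0.
have Bx0 : 0 < B x x by rewrite lt0r innerxx_ge0// andbT; apply: contraNneq x0 => /Bdef ->.
(* A vector of length 2 r cannot be within r of 0. *)
pose s := Num.sqrt (B x x).
have sB : s ^+ 2 = B x x by rewrite sqr_sqrtr// ltW.
have s0 : 0 < s by rewrite sqrtr_gt0.
have [d Dd dx] := Ddense ((2 * r / s) *: x).
exists d; split=> //; apply/eqP => d0; move: dx.
rewrite d0 subr0 !(innerZl BP, innerZr BP) -sB.
have -> : 2 * r / s * (2 * r / s * s ^+ 2) = 4 * r ^+ 2 by field; rewrite gt_eqF.
have : 0 < r ^+ 2 by rewrite exprn_gt0.
by lra.
Qed.

Lemma slope_le x d : D d -> d != 0 ->
  2 * `|B x d| / B d d <= 2 * Num.sqrt (B x x).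
Proof.
move=> Dd d0; have Bdd := Dsep Dd d0.
have Bdd0 : 0 < B d d by lra.
rewrite ler_pdivrMr// -mulrA ler_pM2l//.
rewrite -(@ler_pXn2r _ 2) ?nnegrE ?mulr_ge0 ?sqrtr_ge0 ?(ltW Bdd0)//.
rewrite real_normK ?num_real// exprMn sqr_sqrtr ?innerxx_ge0//.
apply: le_trans (cauchy_schwarz BP _ _) _; rewrite ler_wpM2l ?innerxx_ge0//.
by rewrite expr2 ler_peMl// ltW.
Qed.

Lemma has_sup_slopes x : has_sup (slopes x).
Proof.
split; first by have [d Dd] := lattice_neq0; exists (2 * `|B x d| / B d d), d.
by exists (2 * Num.sqrt (B x x)) => _ [d [Dd d0] <-]; exact: slope_le.
Qed.

Lemma voronoi_norm_ge x d : D d -> d != 0 -> 2 * `|B x d| / B d d <= N x.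
Proof. by move=> Dd d0; apply: ub_le_sup; [exact: (has_sup_slopes x).2|exists d]. Qed.

Lemma voronoi_norm_le x M :
  (forall d, D d -> d != 0 -> 2 * `|B x d| / B d d <= M) -> N x <= M.
Proof.
move=> H; apply: ge_sup; first exact: (has_sup_slopes x).1.
by move=> _ [d [Dd d0] <-]; exact: H.
Qed.

Lemma voronoi_norm_ge0 x : 0 <= N x.
Proof.
have [d [Dd d0]] := lattice_neq0; apply: le_trans (voronoi_norm_ge x Dd d0).
by apply: divr_ge0; [exact: mulr_ge0|exact: innerxx_ge0].
Qed.

Lemma voronoi_normZ_le a x : N (a *: x) <= `|a| * N x.
Proof.
apply: voronoi_norm_le => d Dd d0; rewrite (innerZl BP) normrM mulrCA -mulrA.
by rewrite ler_wpM2l// voronoi_norm_ge.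
Qed.

Lemma voronoi_normZ a x : N (a *: x) = `|a| * N x.
Proof.
apply/eqP; rewrite eq_le voronoi_normZ_le/=.
have [->|a0] := eqVneq a 0; first by rewrite normr0 mul0r voronoi_norm_ge0.
have := voronoi_normZ_le a^-1 (a *: x).
by rewrite scalerA mulVf// scale1r normfV ler_pdivlMl ?normr_gt0.
Qed.

Lemma voronoi_normD x y : N (x + y) <= N x + N y.
Proof.
apply: voronoi_norm_le => d Dd d0; rewrite (innerDl BP).
apply: le_trans (lerD (voronoi_norm_ge x Dd d0) (voronoi_norm_ge y Dd d0)).
rewrite -mulrDl -mulrDr ler_wpM2r ?invr_ge0 ?innerxx_ge0//.
by rewrite ler_wpM2l// ler_normD.
Qed.

Lemma voronoi_norm_le2 x : N x <= 2 * Num.sqrt (B x x).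
Proof. by apply: voronoi_norm_le => d; exact: slope_le. Qed.

(** In the Voronoi cell, 0 is a nearest point of D, so the bound on the distance
    to D bounds the length. *)
Lemma voronoi_cell_bounded x : N x <= 1 -> B x x <= r ^+ 2.
Proof.
move=> Nx; have [d Dd xd] := Ddense x.
have [d0|d0] := eqVneq d 0; first by rewrite d0 subr0 in xd.
have Bdd : 0 < B d d by apply: lt_le_trans (Dsep Dd d0).
have := le_trans (voronoi_norm_ge x Dd d0) Nx.
rewrite ler_pdivrMr// mul1r; have := ler_norm (B x d).
by move: xd; rewrite (inner_sqB BP); lra.
Qed.

Lemma le_voronoi_norm x : Num.sqrt (B x x) <= r * N x.
Proof.
(* Any s > N x scales x into the cell; this also covers N x = 0. *)
have scaled s : N x < s -> Num.sqrt (B x x) <= r * s.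
  move=> xs; have s0 : 0 < s := le_lt_trans (voronoi_norm_ge0 x) xs.
  have := @voronoi_cell_bounded (s^-1 *: x); rewrite voronoi_normZ.
  rewrite normfV gtr0_norm// ler_pdivrMl// mulr1 => /(_ (ltW xs)).
  rewrite !(innerZl BP, innerZr BP) mulrA -invfM -expr2.
  rewrite ler_pdivrMl ?exprn_gt0// -exprMn [s * r]mulrC => H.
  rewrite -[leRHS](ger0_norm (mulr_ge0 (ltW r0) (ltW s0))) -sqrtr_sqr.
  by rewrite ler_sqrt// sqr_ge0.
rewrite leNgt -ltr_pdivlMl//; apply/negP => H.
have H2 := midf_lt H; have := scaled _ H2.1.
by rewrite -ler_pdivrMl// leNgt H2.2.
Qed.

Lemma voronoi_norm_is_norm : is_norm N.
Proof.
split; [exact: voronoi_normD|exact: voronoi_normZ|move=> x Nx; apply: Bdef].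
have := le_voronoi_norm x; rewrite Nx mulr0 => sx.
have : Num.sqrt (B x x) = 0 by apply/eqP; rewrite eq_le sx sqrtr_ge0.
by move/eqP; rewrite sqrtr_eq0 => Bx; apply/eqP; rewrite eq_le Bx innerxx_ge0.
Qed.

Lemma voronoi_norm_separated : Defs.separated N 2 D.
Proof.
move=> x y Dx Dy xy; have d0 : x - y != 0 by rewrite subr_eq0.
have := voronoi_norm_ge (x - y) (DB Dx Dy) d0.
have B1 := Dsep (DB Dx Dy) d0.
have -> // : 2 * `|B (x - y) (x - y)| / B (x - y) (x - y) = 2.
by rewrite ger0_norm ?innerxx_ge0// mulfK//; lra.
Qed.

(** A nearest point of D may not exist, but one that is nearest up to e (for the
    squared distance) is as good up to e: comparing with the competitors d + c
    and d - c bounds the slope along c by 1 + e / B c c, and B c c >= 1. *)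
Lemma voronoi_norm_dense e : 0 < e -> r_dense N (1 + e) D.
Proof.
move=> e0 x; pose A : set R := [set B (x - d) (x - d) | d in D].
have Alb : lbound A 0 by move=> _ [d _ <-]; exact: innerxx_ge0.
have Ainf : has_inf A.
  by split; [exists (B (x - 0) (x - 0)), 0|exists 0].
have [_ [d Dd <-] dx] := inf_adherent e0 Ainf.
exists d => //; apply: voronoi_norm_le => c Dc c0.
have Bcc := Dsep Dc c0.
have near c' : D c' -> 2 * B (x - d) c' <= B c' c' + e.
  move=> Dc'; have : inf A <= B (x - d - c') (x - d - c').
    apply: ge_inf; first by exists 0.
    exists (d + c'); last by rewrite opprD addrA.
    by rewrite -(opprK c'); apply: DB => //; exact: DN.
  by rewrite (inner_sqB BP (x - d)); lra.
rewrite ler_pdivrMr; last by lra.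
apply: (@le_trans _ _ (B c c + e)); last first.
  by rewrite mulrDl mul1r lerD2l ler_peMr// ltW.
have [_|_] := ger0P (B (x - d) c); first exact: near.
by have := near _ (DN Dc); rewrite !(innerNr BP) (innerNl BP) !opprK.
Qed.

Lemma gamma_star_voronoi_norm : gamma_star N = 1%:E.
Proof.
apply/eqP; rewrite eq_le gamma_star_ge1 ?andbT//; last exact: voronoi_norm_is_norm.
apply/lee_addgt0Pr => e e0; rewrite -EFinD; apply: ereal_inf_lbound.
exists (1 + e) => //; split; first by lra.
by exists D; split=> //; [exact: voronoi_norm_dense|exact: voronoi_norm_separated].
Qed.

End Voronoi.

(** * A separated, relatively dense subgroup of ell2 *)

Section FreshLattice.
Context (R : realType) (I : choiceType).
Local Notation code := (seq (I * rat)).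
Context (e : code -> nat -> I).
Hypothesis einj : forall s m t n, e s m = e t n -> s = t /\ m = n.

(** The grading of the coordinates; those that are not of the form e s n are put
    in grade 0 and are never used as fresh coordinates. *)
Definition level (i : I) : nat :=
  if pselect (exists p : code * nat, e p.1 p.2 = i) is left ex then (sval (cid ex)).2
  else 0%N.

Lemma levelE s n : level (e s n) = n.
Proof.
rewrite /level; case: pselect => [ex|[]]; last by exists (s, n).
by case: (cid ex) => -[t m] /= /einj[].
Qed.

Definition code_level (s : code) : nat := \max_(p <- s) level p.1.

(** A coordinate strictly above the grades of the support of the vector coded
    by s, and hence above those of every code of lower or equal level. *)
Definition fresh (s : code) : I := e s (code_level s).+1.

Definition gen (s : code) : ell2 R I := ratvec R s + delta R (fresh s).

(** The matrix of the generators against the fresh coordinates is triangular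
    with unit diagonal, for the order of the levels. *)
Lemma gen_fresh s t : (code_level s <= code_level t)%N ->
  gen s (fresh t) = (s == t)%:R.
Proof.
move=> st; rewrite ell2D ratvec_coord0 ?add0r => [|p ps]; last first.
  apply/eqP => pt; move: st; rewrite leqNgt => /negP; apply.
  have : (level p.1 <= code_level s)%N.
    by rewrite /code_level; exact: (leq_bigmax_seq (F := fun p => level p.1)).
  by rewrite pt levelE.
rewrite deltaE; congr (_%:R); congr (nat_of_bool _).
by apply/eqP/eqP => [/einj[]|->].
Qed.

Definition lattice : set (ell2 R I) :=
  [set x | exists s : seq code, exists n : code -> int,
    uniq s /\ x = \sum_(q <- s) (n q)%:~R *: gen q].

Lemma sum_sub_seq (V : zmodType) (s u : seq code) (F : code -> V) :
  uniq s -> uniq u -> {subset s <= u} ->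
  \sum_(q <- u) (if q \in s then F q else 0) = \sum_(q <- s) F q.
Proof.
move=> us uu su; rewrite -big_mkcond -big_filter; apply: perm_big.
apply: uniq_perm => [||q]; rewrite ?filter_uniq// mem_filter andb_idr//.
exact: su.
Qed.

Lemma lattice_zmod_closed : zmod_closed (mem lattice).
Proof.
split=> [|x y]; first by apply/mem_set; exists [::], (fun=> 0); rewrite big_nil.
move=> /set_mem[s [n [us ->]]] /set_mem[t [m [ut ->]]]; apply/mem_set.
pose u := undup (s ++ t).
exists u, (fun q => (if q \in s then n q else 0) - (if q \in t then m q else 0)).
split; first exact: undup_uniq.
rewrite -(@sum_sub_seq _ s u) ?undup_uniq//; last first.
  by move=> q qs; rewrite mem_undup mem_cat qs.
rewrite -(@sum_sub_seq _ t u) ?undup_uniq//; last first.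
  by move=> q qt; rewrite mem_undup mem_cat qt orbT.
rewrite -sumrB; apply: eq_bigr => q _; rewrite rmorphB/= scalerBl.
by congr (_ - _); case: ifP; rewrite ?scale0r.
Qed.

Lemma seq_max_level (s : seq code) : s != [::] ->
  exists2 t, t \in s & forall q, q \in s -> (code_level q <= code_level t)%N.
Proof.
elim: s => // a [_ _|b s /(_ isT)[t ts tmax] _].
  by exists a; rewrite ?mem_head// => q; rewrite inE => /eqP ->.
have [at_|ta] := leqP (code_level a) (code_level t).
  exists t; first by rewrite inE ts orbT.
  by move=> q; rewrite inE => /orP[/eqP ->//|/tmax].
exists a; first exact: mem_head.
move=> q; rewrite inE => /orP[/eqP ->//|/tmax qt].
exact: leq_trans qt (ltnW ta).
Qed.

(** In a reduced combination, a code t of maximal level leaves its coefficient,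
    a nonzero integer, alone at the coordinate fresh t. *)
Lemma lattice_separated x : lattice x -> x != 0 -> 1 <= `|x|.
Proof.
move=> [s [n [us ->]]].
pose s' := [seq q <- s | n q != 0].
have -> : \sum_(q <- s) (n q)%:~R *: gen q = \sum_(q <- s') (n q)%:~R *: gen q.
  rewrite /s' big_filter [RHS]big_mkcond; apply: eq_bigr => q _.
  by case: eqP => //= ->; rewrite scale0r.
have us' : uniq s' by rewrite filter_uniq.
have [->|s0] := eqVneq s' [::]; first by rewrite big_nil eqxx.
have [t ts tmax] := seq_max_level s0; move=> _.
apply: le_trans (coord_le _ (fresh t)).
rewrite ell2_sumE (bigD1_seq t)//= big_seq_cond big1 => [|q /andP[qs qt]].
  rewrite addr0 ell2Z gen_fresh// eqxx mulr1.
  move: ts; rewrite mem_filter => /andP[nt _].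
  by rewrite -intr_norm -[1]/(1%:~R) ler_int -gtz0_ge1 normr_gt0.
by rewrite ell2Z gen_fresh ?tmax// (negPf qt) mulr0.
Qed.

Lemma lattice_dense x : exists2 d, lattice d & `|x - d| <= 2.
Proof.
have [s xs] := ratvec_dense x (@ltr01 R).
exists (gen s).
  by exists [:: s], (fun=> 1); rewrite big_seq1 scale1r.
rewrite /gen opprD addrA; apply: le_trans (ler_normB _ _) _.
by rewrite norm_delta; lra.
Qed.

End FreshLattice.

Lemma dot_inner (R : realType) (I : choiceType) : inner_product (@dot R I).
Proof.
split; [exact: dotC|exact: dotDl|exact: dotZl|move=> x].
by rewrite dotxx sqr_ge0.
Qed.

(** The lattice is 1-separated and 2-dense for the Euclidean norm, so its Voronoi
    norm N satisfies |x| / 2 <= N x <= 2 |x|. *)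
Lemma ell2_renorming (R : realType) (I : choiceType) : infinite_set [set: I] ->
  exists N : ell2 R I -> R,
    [/\ is_norm N, equivalent_norms (fun x : ell2 R I => `|x|) N
      & gamma_star N = 1%:E].
Proof.
move=> infI; have [e einj] := infinite_seq_code rat infI.
pose B := @dot R I; pose D := @lattice R I e.
have BP : inner_product B := @dot_inner R I.
have sqrtB x : Num.sqrt (B x x) = `|x| by rewrite /B dotxx sqrtr_sqr normr_id.
have Bdef x : B x x = 0 -> x = 0.
  by rewrite /B dotxx => /eqP; rewrite sqrf_eq0 normr_eq0 => /eqP.
have Dsep d : D d -> d != 0 -> 1 <= B d d.
  move=> Dd d0; rewrite /B dotxx expr_ge1//.
  exact: (lattice_separated einj).
have Ddense x : exists2 d, D d & B (x - d) (x - d) <= 2 ^+ 2.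
  have [d Dd xd] := lattice_dense e x; exists d => //.
  by rewrite /B dotxx ler_sqr ?nnegrE.
have Vn0 : exists x : ell2 R I, x != 0.
  have [i _] := infinite_setN0 infI.
  by exists (delta R i); rewrite -normr_gt0 norm_delta.
have Dz := @lattice_zmod_closed R I e.
have r0 : 0 < 2 :> R by [].
exists (voronoi_norm B D); split.
- exact: (voronoi_norm_is_norm BP Bdef Dsep Ddense r0 Vn0).
- exists 2^-1, 2; split=> // x; split.
    have := le_voronoi_norm BP Bdef Dsep Ddense r0 Vn0 x.
    by rewrite sqrtB ler_pdivrMl.
  by rewrite -sqrtB; exact: (voronoi_norm_le2 BP Bdef Dsep Ddense r0 Vn0 x).
- exact: (gamma_star_voronoi_norm BP Bdef Dz Dsep Ddense r0 Vn0).
Qed.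

(** * Completeness and renormings *)

Section Complete.
Context (R : realType) (I : choiceType).

Lemma esqsum_le (f : I -> R^o) (c : R) :
  (forall s : seq I, uniq s -> \sum_(i <- s) f i ^+ 2 <= c) ->
  (esqsum f <= c%:E)%E.
Proof.
move=> fc; apply: ge_ereal_sup => _ [A [finA _] <-].
rewrite fsbig_finite//= sumEFin lee_fin; apply: fc.
exact: finmap.fset_uniq.
Qed.

(** The coordinates of a Cauchy filter converge to some l.  A bound on the finite
    partial sums of |x - y|^2 that holds for all y far in the filter passes to
    the limit in y, so x - l is square-summable and small. *)
Lemma ell2_complete (F : set_system (ell2 R I)) :
  ProperFilter F -> cauchy F -> cvg F.
Proof.
move=> FF /cauchyP Fc; apply/cvg_ex => /=.
have coord_cvg i : cvg ((fun x : ell2 R I => x i : R^o) @ F).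
  apply: R_complete; apply: cauchy_exP => e e0.
  have [x Fx] := Fc _ e0; exists (x i).
  suff : F [set y : ell2 R I | ball (x i : R^o) e (y i : R^o)] by [].
  apply: filterS Fx => y /=.
  rewrite -!ball_normE /ball_/= => xy.
  by apply: le_lt_trans xy; have := coord_le (x - y) i; rewrite ell2D ell2N.
pose l i : R^o := lim ((fun x : ell2 R I => x i : R^o) @ F).
have close e : 0 < e -> {near F, forall x : ell2 R I, forall s : seq I,
    uniq s -> \sum_(i <- s) (x i - l i) ^+ 2 <= e ^+ 2}.
  move=> e0; have e20 : 0 < e / 2 by lra.
  have [x0 Fx0] := Fc _ e20.
  near=> x => s us.
  have cv : (fun y : ell2 R I => \sum_(i <- s) (x i - y i) ^+ 2 : R^o) @ F -->
      (\sum_(i <- s) (x i - l i) ^+ 2 : R^o).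
    elim: s {us} => [|i s IHs].
      rewrite big_nil; under eq_fun do rewrite big_nil; exact: cvg_cst.
    rewrite big_cons; under eq_fun do rewrite big_cons.
    apply: cvgD => //; rewrite expr2; under eq_fun do rewrite expr2.
    have xl : (fun y : ell2 R I => x i - y i : R^o) @ F --> (x i - l i : R^o).
      by apply: cvgB; [exact: cvg_cst|exact: coord_cvg].
    exact: cvgM.
  rewrite -(cvg_lim _ cv)//; apply: limr_le; first by apply/cvg_ex; eexists; exact: cv.
  near=> y.
  have xy : `|x - y| <= e.
    have : ball x0 (e / 2) x by near: x.
    have : ball x0 (e / 2) y by near: y.
    rewrite -!ball_normE /ball_/= => yx xx.
    rewrite -(subrK x0 x) -addrA; apply: le_trans (ler_normD _ _) _.
    by rewrite distrC; lra.
  apply: (le_trans (sumsq_le (x - y) us)).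
  by rewrite ler_sqr ?nnegrE// ltW.
have lP : l \in @square_summable R I.
  have [x xl] := @filter_ex _ F _ _ (close 1 ltr01).
  have dP : (fun i => x i - l i) \in @square_summable R I.
    by rewrite square_summableE (le_lt_trans (esqsum_le xl))// ltry.
  have -> : l = (ell2_fun x : I -> R^o) - (fun i => x i - l i).
    by apply/funext => i; apply/esym; exact: (subKr (x i : R) (l i)).
  by apply: rpredB => //; exact: ell2_funP.
exists (Ell2 lP); apply/cvgrPdist_le => e e0.
near=> x.
rewrite distrC -(@ler_pXn2r _ 2) ?nnegrE ?(ltW e0)// -lee_fin -ell2E.
apply: esqsum_le; near: x; exact: close.
Unshelve. all: by end_near. Qed.

HB.instance Definition _ := Uniform_isComplete.Build (ell2 R I) ell2_complete.

End Complete.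

Section Renorm.
Context (R : realType) (V : completeNormedModType R) (N : V -> R).
Hypotheses (NP : is_norm N) (NE : equivalent_norms (fun x : V => `|x|) N).

(** A type of its own for the vectors of V, on which N can be declared as the
    norm; the hypotheses on N are arguments because the instances depend on
    them. *)
Definition renorm of is_norm N & equivalent_norms (fun x : V => `|x|) N : Type := V.

Local Notation W := (renorm NP NE).

HB.instance Definition _ := GRing.Lmodule.copy W V.

Let ND (x y : W) : N (x + y) <= N x + N y.
Proof. by have [H _ _] := NP; exact: H. Qed.
Let NZ (a : R) (x : W) : N (a *: x) = `|a| * N x.
Proof. by have [_ H _] := NP; exact: H. Qed.
Let N0 (x : W) : N x = 0 -> x = 0.
Proof. by have [_ _ H] := NP; exact: H. Qed.

HB.instance Definition _ := Lmodule_isNormed.Build R W ND NZ N0.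

Lemma renormE (x : W) : `|x| = N x. Proof. by []. Qed.

Lemma renorm_complete (F : set_system W) : ProperFilter F -> cauchy F -> cvg F.
Proof.
move=> FF /cauchyP Fc.
have [c [C [c0 C0 cC]]] := NE.
have : cvg (F : set_system V).
  apply: cauchy_cvg; apply/cauchyP => e e0.
  have ce0 : 0 < c * e by rewrite mulr_gt0.
  have [x Fx] := Fc _ ce0; exists x; apply: filterS Fx => y.
  rewrite -!ball_normE /ball_/= renormE => xy.
  have [H _] := cC (x - y : V).
  by rewrite -(ltr_pM2l c0); exact: le_lt_trans xy.
move=> /cvg_ex[l Fl]; apply/cvg_ex; exists (l : W).
apply/cvgrPdist_le => e e0.
have eC0 : 0 < e / C by rewrite divr_gt0.
have /cvgrPdist_le/(_ _ eC0) := Fl; apply: filterS => x xl.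
have [_ H] := cC (l - x : V).
by apply: (le_trans H); rewrite mulrC -ler_pdivlMr.
Qed.

HB.instance Definition _ := Uniform_isComplete.Build W renorm_complete.

End Renorm.

(** * Infinite dimension and separability *)

(** If n vectors spanned the space, the rows of the n x (n+1) matrix of their
    first n+1 coordinates would span all rows of that length. *)
Lemma ell2_infinite_dimensional (R : realType) :
  infinite_dimensional (ell2 R nat).
Proof.
move=> n v; apply/eqP => spanT.
pose A : 'M[R]_(n, n.+1) := \matrix_(i, j) v i j.
have : row_full A.
  rewrite -sub1mx; apply/row_subP => j; apply/submxP.
  have : lin_span v (delta R (val j)) by rewrite spanT.
  move=> [c cE]; exists (\row_i c i); apply/rowP => k.
  rewrite !mxE [LHS](_ : _ = delta R (val j) (val k)); last first.
    by rewrite deltaE eq_sym.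
  by rewrite cE ell2_sumE; apply: eq_bigr => i _; rewrite !mxE.
by move=> /eqP rA; have := rank_leq_row A; rewrite rA ltnn.
Qed.

Lemma renorm_separable (R : realType) (N : ell2 R nat -> R)
    (NP : is_norm N) (NE : equivalent_norms (fun x : ell2 R nat => `|x|) N) :
  separable (renorm NP NE).
Proof.
exists (range (@ratvec R nat)).
  by apply: card_le_trans (card_image_le _ _) _; exact: countableP.
move=> O [x Ox] openO.
have [c [C [c0 C0 cC]]] := NE.
have /nbhs_ballP[e /= e0 eO] : nbhs x O by exact: open_nbhs_nbhs.
have eC0 : 0 < e / C by rewrite divr_gt0.
have [s xs] := ratvec_dense (x : ell2 R nat) eC0.
exists (ratvec R s); split; last by exists s.
apply: eO; rewrite -ball_normE /ball_/= renormE.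
have [_ H] := cC (x - ratvec R s : ell2 R nat).
by apply: (le_lt_trans H); rewrite mulrC -ltr_pdivlMr.
Qed.

(** * Riesz representation and reflexivity *)

Section InnerBound.
Context (R : realType) (V : normedModType R) (B : V -> V -> R) (M : R).
Hypotheses (BP : inner_product B) (Ble : forall y, B y y <= M * `|y| ^+ 2).

Lemma inner_form_bound y z : `|B y z| <= Num.max M 0 * `|y| * `|z|.
Proof.
set K := Num.max M 0.
have K0 : 0 <= K by rewrite /K le_max lexx orbT.
have BK x : B x x <= K * `|x| ^+ 2.
  by apply: le_trans (Ble x) _; rewrite ler_wpM2r ?sqr_ge0// /K le_max lexx.
rewrite -(@ler_pXn2r _ 2) ?nnegrE ?mulr_ge0// real_normK ?num_real//.
apply: (le_trans (cauchy_schwarz BP y z)).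
apply: (@le_trans _ _ ((K * `|y| ^+ 2) * (K * `|z| ^+ 2))).
  by apply: ler_pM; rewrite ?(innerxx_ge0 BP).
by rewrite !exprMn le_eqVlt; apply/orP; left; apply/eqP; ring.
Qed.

End InnerBound.

Section Riesz.
Context (R : realType) (Y : completeNormedModType R) (B : Y -> Y -> R).
Context (m M : R).
Hypotheses (BP : inner_product B) (m0 : 0 < m)
  (Bge : forall y, m * `|y| ^+ 2 <= B y y)
  (Ble : forall y, B y y <= M * `|y| ^+ 2).

(** The form in which functionals are produced below: linear with an explicit
    bound. *)
Lemma bounded_linear_dual (f : Y -> R^o) (K : R) : linear f ->
  (forall y, `|f y| <= K * `|y|) -> f \in @continuous_linear R Y.
Proof.
move=> lf fK; apply/asboolP; split=> //.
pose L := GRing.isLinear.Build R Y R^o *:%R f lf.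
pose F : {linear Y -> R^o} := HB.pack f L.
suff : continuous F by [].
apply/linear_bounded_continuous/bounded_funP => r.
exists (`|K| * r) => x xr; apply: (le_trans (fK x)).
apply: (@le_trans _ _ (`|K| * `|x|)); first by rewrite ler_wpM2r// ler_norm.
by rewrite ler_wpM2l.
Qed.

(** Minimize J y = B y y - 2 f y, whose minimum is attained where f = B z.  J is
    bounded below, since f is bounded and B dominates the norm.  Since J restricted
    to a line is a quadratic polynomial with leading coefficient B h h, two almost
    minimizers are close to each other: the almost minimizers form a Cauchy
    filter, which converges to some z, and the variation of J at z vanishes. *)
Lemma riesz (f : dual Y) : exists z, forall y, f y = B z y.
Proof.
pose J y : R := B y y - 2 * f y.
have fD x y : f (x + y) = f x + f y.
  by have := dual_linear f 1 x y; rewrite scale1r => ->; rewrite scale1r.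
have JD y h t : J (y + t *: h) = J y + t ^+ 2 * B h h + 2 * t * (B y h - f h).
  rewrite /J (inner_sqD BP) !(innerZl BP, innerZr BP) fD dualZ.
  by rewrite expr2; ring.
pose E := range J; pose K := dual_norm f.
have K0 : 0 <= K := dual_norm_ge0 f.
have Elb : lbound E (- (K ^+ 2 / m)).
  move=> _ [y _ <-]; have := Bge y; have := dual_norm_ge f y.
  have := ler_norm (f y); rewrite /J -/K => fy fn By.
  have : 0 <= (m * `|y| - K) ^+ 2 / m by rewrite divr_ge0 ?sqr_ge0// ltW.
  have -> : (m * `|y| - K) ^+ 2 / m = m * `|y| ^+ 2 - 2 * (K * `|y|) + K ^+ 2 / m.
    by field; rewrite gt_eqF.
  by lra.
have Einf : has_inf E by split; [exists (J 0), 0|exists (- (K ^+ 2 / m))].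
pose j := inf E.
have jJ y : j <= J y by apply: ge_inf; [exact: Einf.2|exists y].
pose A e := [set y | J y < j + e].
have A0 e : 0 < e -> A e !=set0.
  by move=> e0; have [_ [y _ <-] yj] := inf_adherent e0 Einf; exists y.
(* The value of J at the midpoint of x and y is at least j. *)
have Adiam e x y : A e x -> A e y -> m * `|x - y| ^+ 2 <= 4 * e.
  rewrite /A /= => xA yA; apply: (le_trans (Bge _)).
  have := jJ (y + 2^-1 *: (x - y)); rewrite JD.
  have : J x = J (y + 1 *: (x - y)) by rewrite scale1r addrC subrK.
  rewrite JD; move: (B (x - y) (x - y)) (B y (x - y) - f (x - y)) => a b.
  by lra.
pose F := filter_from [set e : R | 0 < e] A.
have FF : ProperFilter F.
  apply: filter_from_proper; last by move=> e; exact: A0.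
  apply: filter_from_filter; first by exists 1 => /=.
  move=> d e /= d0 e0; exists (Num.min d e); first by rewrite /= lt_min d0.
  move=> y; rewrite /A /= => yA; split; apply: (lt_le_trans yA).
    by rewrite lerD2l ge_min lexx.
  by rewrite lerD2l ge_min lexx orbT.
have Fc : cauchy F.
  apply: cauchy_exP => e e0; pose d := m * e ^+ 2 / 8.
  have e20 : 0 < e ^+ 2 by rewrite exprn_gt0.
  have d0 : 0 < d by rewrite /d divr_gt0// mulr_gt0.
  have [x xA] := A0 _ d0; exists x; exists d => //= y yA.
  rewrite -ball_normE /ball_/=.
  rewrite -(@ltr_pXn2r _ 2) ?nnegrE ?(ltW e0)// -(ltr_pM2l m0).
  apply: (le_lt_trans (Adiam _ _ _ xA yA)).
  have : 0 < m * e ^+ 2 by rewrite mulr_gt0.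
  by rewrite /d; lra.
have FA e : 0 < e -> F (A e) by move=> e0; exists e.
clearbody F.
have /cvg_ex[/= z Fz] := @cauchy_cvg _ F FF Fc.
exists z => h; apply/eqP; rewrite eq_sym -subr_eq0; apply/eqP.
set b := B z h - f h.
pose C := Num.max M 0 * `|h|.
have C0 : 0 <= C by rewrite mulr_ge0// le_max lexx orbT.
(* Moving from an almost minimizer y along t h cannot lower J by more than the
   defect e / 2 of y; replacing y by z costs another e / 2 when y is near z. *)
have quad t e : 0 < e -> 0 <= t ^+ 2 * B h h + 2 * t * b + e.
  move=> e0; have e20 : 0 < e / 2 by lra.
  pose d := e / (4 * (`|t| * C + 1)).
  have tC : 0 <= `|t| * C by rewrite mulr_ge0.
  have tC0 : 0 < `|t| * C + 1 by lra.
  have d0 : 0 < d by rewrite /d divr_gt0// mulr_gt0.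
  have /cvgrPdist_le/(_ _ d0) zF := Fz.
  have [y [zy yA]] := filter_ex (filterI zF (FA _ e20)).
  have := jJ (y + t *: h); rewrite JD.
  have -> : B y h - f h = b - B (z - y) h by rewrite /b (innerDl BP) (innerNl BP); ring.
  have : `|2 * t * B (z - y) h| <= e / 2.
    rewrite !normrM normr_nat.
    apply: (@le_trans _ _ (2 * `|t| * (C * d))).
      rewrite ler_wpM2l ?mulr_ge0//; apply: (le_trans (inner_form_bound BP Ble _ _)).
      by rewrite /C mulrAC ler_wpM2l// mulr_ge0// le_max lexx orbT.
    have -> : 2 * `|t| * (C * d) = (`|t| * C) / (`|t| * C + 1) * (e / 2).
      by rewrite /d; field; rewrite gt_eqF.
    by rewrite ler_piMl ?(ltW e20)// ler_pdivrMr// mul1r; lra.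
  have := ler_norm (- (2 * t * B (z - y) h)); rewrite normrN.
  by move: yA; rewrite /A/=; lra.
have quad0 t : 0 <= t ^+ 2 * B h h + 2 * t * b.
  rewrite -(addr0 (_ + _)); apply/ler_addgt0Pr => e e0.
  by rewrite addr0; exact: quad.
have := innerxx_ge0 BP h; move: (B h h) quad0 => a quad0 a0.
(* The minimum is at - b / a; a + 1 avoids the case distinction a = 0. *)
have := quad0 (- b / (a + 1)).
have -> : (- b / (a + 1)) ^+ 2 * a + 2 * (- b / (a + 1)) * b =
  - (b ^+ 2 * ((a + 2) / (a + 1) ^+ 2)) by field; lra.
rewrite oppr_ge0 pmulr_lle0; last by rewrite divr_gt0 ?exprn_gt0//; lra.
by move=> b0; apply/eqP; rewrite -sqrf_eq0 eq_le b0 sqr_ge0.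
Qed.

Lemma inner_dual_subproof y :
  (fun x => B x y : R^o) \in @continuous_linear R Y.
Proof.
apply: (@bounded_linear_dual _ (Num.max M 0 * `|y|)) => [a x z|x].
  by rewrite (innerDl BP) (innerZl BP).
by rewrite mulrAC; exact: (inner_form_bound BP Ble).
Qed.

Definition inner_dual y : dual Y := Dual (inner_dual_subproof y).

Lemma inner_dual_linear a y z :
  inner_dual (a *: y + z) = a *: inner_dual y + inner_dual z.
Proof.
apply/val_inj/funext => x.
have H : B x (a *: y + z) = a * B x y + B x z.
  by rewrite (innerDr BP) (innerZr BP).
exact: H.
Qed.

(** By Riesz, the functionals on Y are the inner_dual y; a functional Phi on the
    dual then gives a functional y |-> Phi (inner_dual y) on Y, which is again
    represented by some x. *)
Lemma inner_reflexive : reflexive_space Y.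
Proof.
move=> Phi.
have g_in : (fun y => Phi (inner_dual y) : R^o) \in @continuous_linear R Y.
  apply: (@bounded_linear_dual _ (dual_norm Phi * Num.max M 0)) => [a y z|y].
    by rewrite inner_dual_linear dual_linear.
  apply: (le_trans (dual_norm_ge Phi _)).
  rewrite -mulrA ler_wpM2l ?dual_norm_ge0//.
  apply: dual_norm_le => x x1.
  apply: (le_trans (inner_form_bound BP Ble x y)).
  rewrite mulrAC ler_piMr// mulr_ge0// le_max lexx orbT//.
have [x xE] := riesz (Dual g_in).
exists x => f; have [y yE] := riesz f.
have -> : f = inner_dual y.
  by apply/val_inj/funext => z; rewrite [LHS]yE (innerC BP).
exact: xE.
Qed.

End Riesz.

(** * Finite representability in a Hilbertian space *)

Section UltraLimit.
Context (R : realType) (T : Type) (U : set_system T).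
Hypothesis UU : UltraFilter U.

(** A segment is compact, so the image filter has a cluster point; along an
    ultrafilter a cluster point is a limit. *)
Lemma bounded_ultra_cvg (f : T -> R^o) (K : R) :
  U [set s | `|f s| <= K] -> cvg (f @ U).
Proof.
move=> fK; have fU : (f @ U) [set` `[- K, K]].
  suff : U [set s | f s \in `[- K, K]] by [].
  by apply: filterS fK => s; rewrite /= in_itv /= ler_norml.
have [p [_ clp]] := @segment_compact R (- K) K (f @ U) _ fU.
apply/cvg_ex; exists p => W Wp.
have [//|nW] := in_ultra_setVsetC (f @^-1` W) UU.
by have [x []] := clp (~` W) W nW Wp.
Qed.

Lemma near_eq_limits (f g : T -> R^o) (a b : R) :
  U [set s | f s = g s] -> f @ U --> (a : R^o) -> g @ U --> (b : R^o) -> a = b.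
Proof.
move=> fg fa gb.
have ga : g @ U --> (a : R^o) by apply: cvg_trans fa; exact: near_eq_cvg.
by rewrite -(norm_cvg_lim ga) -(norm_cvg_lim gb).
Qed.

End UltraLimit.

Section SuperReflexive.
Context (R : realType) (X : normedModType R) (B : X -> X -> R) (m M : R).
Hypotheses (BP : inner_product B) (m0 : 0 < m) (M0 : 0 <= M)
  (Bge : forall y, m * `|y| ^+ 2 <= B y y)
  (Ble : forall y, B y y <= M * `|y| ^+ 2).

Lemma mem_lin_span (V : lmodType R) (s : seq V) y :
  y \in s -> lin_span (tnth (in_tuple s)) y.
Proof.
move=> /seq_tnthP[k ->]; exists (fun i => (i == k)%:R).
rewrite (bigD1 k)//= eqxx scale1r big1 ?addr0// => i /negPf ->.
by rewrite scale0r.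
Qed.

(** The finite lists s of vectors of Y, directed by inclusion, carry an
    ultrafilter that contains, for each y, the lists through y.  With T s an
    isomorphism (up to factors 1/2 and 3/2) of the span of s into X, the limit of
    B (T s y) (T s z) is bilinear because each identity involves finitely many
    vectors, and hence holds for eventually all s. *)
Lemma inner_super_reflexive : super_reflexive X.
Proof.
move=> Y finrep.
have /choice[T TP] : forall s : seq Y, exists T : Y -> X,
    (forall a y z, y \in s -> z \in s -> T (a *: y + z) = a *: T y + T z) /\
    (forall y, y \in s -> 2^-1 * `|y| <= `|T y| <= 3 / 2 * `|y|).
  move=> s; have half0 : 0 < 2^-1 :> R by [].
  have [T [Tl Tb]] := finrep _ _ (tnth (in_tuple s)) half0.
  exists T; split=> [a y z /mem_lin_span ys /mem_lin_span zs|y /mem_lin_span ys].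
    exact: Tl.
  by have [H1 H2] := Tb _ ys; apply/andP; split; lra.
pose F0 := filter_from setT (fun t : seq Y => [set s : seq Y | {subset t <= s}]).
have F0F : ProperFilter F0.
  apply: filter_from_proper; last by move=> t _; exists t.
  apply: filter_fromT_filter; first by exists [::].
  move=> t u; exists (t ++ u) => s /= tus; split=> y yt; apply: tus;
    by rewrite mem_cat yt ?orbT.
have [U [UU F0U]] := ultraFilterLemma F0F.
have Umem (t : seq Y) : U [set s : seq Y | {subset t <= s}] by apply: F0U; exists t.
pose b y z (s : seq Y) : R^o := B (T s y) (T s z).
pose L y z : R := lim (b y z @ U).
pose K := Num.max M 0.
have K0 : 0 <= K by rewrite le_max lexx orbT.
have bL y z : b y z @ U --> (L y z : R^o).
  apply: (bounded_ultra_cvg UU (K := K * (3 / 2 * `|y|) * (3 / 2 * `|z|))).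
  apply: filterS (Umem [:: y; z]) => s /= yzs.
  have [_ Tb] := TP s.
  have /andP[_ yb] := Tb y (yzs _ (mem_head _ _)).
  have /andP[_ zb] : 2^-1 * `|z| <= `|T s z| <= 3 / 2 * `|z|.
    by apply: Tb; apply: yzs; rewrite !inE eqxx orbT.
  apply: (le_trans (inner_form_bound BP Ble _ _)).
  by apply: ler_pM => //; rewrite ?mulr_ge0// ler_wpM2l.
have LP : inner_product L.
  split=> [y z|x y z|a y z|y].
  - apply: (near_eq_limits UU _ (bL y z) (bL z y)).
    by apply: filterE => s /=; rewrite /b (innerC BP).
  - have xyz : (fun s => b x z s + b y z s : R^o) @ U --> (L x z + L y z : R^o).
      by apply: cvgD; exact: bL.
    apply: (near_eq_limits UU _ (bL (x + y) z) xyz).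
    apply: filterS (Umem [:: x; y; z]) => s /= xyzs.
    have [Tl _] := TP s; rewrite /b -(scale1r x) Tl ?scale1r ?(innerDl BP)//.
      by apply: xyzs; rewrite !inE eqxx.
    by apply: xyzs; rewrite !inE eqxx orbT.
  - have yz : (fun s => a * b y z s : R^o) @ U --> (a * L y z : R^o).
      by apply: cvgM; [exact: cvg_cst|exact: bL].
    apply: (near_eq_limits UU _ (bL (a *: y) z) yz).
    (* T s is only known to respect combinations a y + z of two members of s, so a
       multiple of y alone needs the member z = 0. *)
    apply: filterS (Umem [:: y; 0]) => s /= y0s.
    have [Tl Tb] := TP s.
    have y_s : y \in s by apply: y0s; rewrite !inE eqxx.
    have z_s : 0 \in s by apply: y0s; rewrite !inE eqxx orbT.
    have T0 : T s 0 = 0.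
      by have := Tb _ z_s; rewrite !normr0 !mulr0 normr_le0 => /andP[_ /eqP].
    by rewrite /b -(addr0 (a *: y)) Tl// T0 addr0 (innerZl BP).
  - apply: limr_ge; first by apply/cvg_ex; exists (L y y); exact: bL.
    by apply: filterE => s; exact: innerxx_ge0.
apply: (@inner_reflexive R Y L (m / 4) (M * (9 / 4))) => //.
- by rewrite divr_gt0.
- move=> y; apply: limr_ge; first by apply/cvg_ex; exists (L y y); exact: bL.
  apply: filterS (Umem [:: y]) => s /= ys.
  have [_ Tb] := TP s.
  have /andP[yb _] := Tb y (ys _ (mem_head _ _)).
  apply: le_trans (Bge _); rewrite -mulrA ler_pM2l//.
  have -> : 4^-1 * `|y| ^+ 2 = (2^-1 * `|y|) ^+ 2 by field.
  by rewrite ler_sqr ?nnegrE// mulr_ge0.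
- move=> y; apply: limr_le; first by apply/cvg_ex; exists (L y y); exact: bL.
  apply: filterS (Umem [:: y]) => s /= ys.
  have [_ Tb] := TP s.
  have /andP[_ yb] := Tb y (ys _ (mem_head _ _)).
  apply: (le_trans (Ble _)); rewrite -mulrA ler_wpM2l//.
  have -> : 9 / 4 * `|y| ^+ 2 = (3 / 2 * `|y|) ^+ 2 by field.
  by rewrite ler_sqr ?nnegrE// mulr_ge0.
Qed.

End SuperReflexive.

(** * The theorem *)

Lemma renorm_super_reflexive (R : realType) (I : choiceType) (N : ell2 R I -> R)
    (NP : is_norm N) (NE : equivalent_norms (fun x : ell2 R I => `|x|) N) :
  super_reflexive (renorm NP NE).
Proof.
have [c [C [c0 C0 cC]]] := NE.
have Nge0 (x : renorm NP NE) : 0 <= N x by rewrite -renormE.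
apply: (@inner_super_reflexive R (renorm NP NE) (@dot R I) (C ^- 2) (c ^- 2)).
- exact: dot_inner.
- by rewrite invr_gt0 exprn_gt0.
- by rewrite invr_ge0 exprn_ge0// ltW.
- move=> y; rewrite renormE dotxx ler_pdivrMl ?exprn_gt0// -exprMn.
  have [_ yC] := cC y.
  by rewrite ler_sqr ?nnegrE ?mulr_ge0 ?(ltW C0).
- move=> y; rewrite renormE dotxx ler_pdivlMl ?exprn_gt0// -exprMn.
  have [cy _] := cC y.
  by rewrite ler_sqr ?nnegrE ?mulr_ge0 ?(ltW c0).
Qed.

Theorem proposition6p8 (R : realType) :
  (forall I : choiceType, infinite_set [set: I] ->
     exists N : ell2 R I -> R,
       [/\ is_norm N,
           equivalent_norms (fun x : ell2 R I => `|x|) N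
         & gamma_star N = 1%:E]) /\
  (exists X : completeNormedModType R,
     [/\ infinite_dimensional X,
         separable X,
         super_reflexive X
       & gamma_star (fun x : X => `|x|) = 1%:E]).
Proof.
split=> [I|]; first exact: ell2_renorming.
have [N [NP NE gN]] := ell2_renorming R infinite_nat.
exists (renorm NP NE); split.
- exact: (@ell2_infinite_dimensional R).
- exact: renorm_separable.
- exact: renorm_super_reflexive.
- exact: gN.
Qed.
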